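(* For any $V,W\in G(X)$, $d_{FS}(V,W)=\hat{\Theta}_{V,W}$, where $\hat{\Theta}_{V,W}=\max\{\Theta_{V,W},\Theta_{W,V}\}$ is the max-symmetrized Grassmann angle.
   Context: $X$ is an $n$-dimensional vector space over $\mathbb{R}$ (real case) or $\mathbb{C}$ (complex case) with an inner product $\langle\cdot,\cdot\rangle$ (Hermitian in the complex case, conjugate-linear in the left entry). Subspaces and dimensions are over the same field. Principal angles: for nonzero subspaces $V,W\subset X$, with $p=\dim V$, $q=\dim W$, $m=\min\{p,q\}$, there are orthonormal bases $(e_1,\dots,e_p)$ of $V$ and $(f_1,\dots,f_q)$ of $W$ and uniquely determined numbers $0\le\theta_1\le\dots\le\theta_m\le\frac{\pi}{2}$ (the principal angles) such that $\langle e_i,f_j\rangle=\delta_{ij}\cos\theta_i$ (equal to $0$ whenever $i\neq j$). Grassmann angle: for nonzero subspaces $V,W\subset X$ with principal angles $\theta_1,\dots,\theta_m$, the Grassmann angle $\Theta_{V,W}\in[0,\frac{\pi}{2}]$ of $V$ with $W$ is $\Theta_{V,W}=\arccos(\cos\theta_1\cdots\cos\theta_m)$ if $\dim V\le\dim W$, and $\Theta_{V,W}=\frac{\pi}{2}$ if $\dim V>\dim W$. Also $\Theta_{\{0\},\{0\}}=\Theta_{\{0\},V}=0$ and $\Theta_{V,\{0\}}=\frac{\pi}{2}$ for $V\ne\{0\}$. Grassmann algebra: $\Lambda X=\bigoplus_p\Lambda^pX$ has the inner product determined by $\langle v_1\wedge\dots\wedge v_p,w_1\wedge\dots\wedge w_p\rangle=\det(\langle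 v_i,w_j\rangle)$, with distinct $\Lambda^pX$'s orthogonal, and $\langle\nu,\omega\rangle=\bar\nu\omega$ for scalars $\nu,\omega\in\Lambda^0X$. The full Grassmannian $G(X)$ is the set of all subspaces of $X$ (of all dimensions $0,\dots,n$), embedded in the projective space $\mathbb{P}(\Lambda X)$ by the Plücker embedding, which maps each $k$-dimensional subspace $U$ to the line $\Lambda^kU$. On a projective space the Fubini-Study distance is $d_{FS}(\operatorname{span}(v),\operatorname{span}(w))=\arccos\frac{|\langle v,w\rangle|}{\|v\|\|w\|}$, and for $V,W\in G(X)$, $d_{FS}(V,W)$ means the Fubini-Study distance between their images in $\mathbb{P}(\Lambda X)$. *)

(* Defs.v *)
From HB Require Import structures.
From mathcomp Require Import all_boot all_order all_algebra.
From mathcomp Require Import complex.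
From mathcomp Require Import all_classical all_reals trigo.

Set Implicit Arguments.
Unset Strict Implicit.
Unset Printing Implicit Defensive.

Import Order.TTheory GRing.Theory Num.Theory.

Local Open Scope ring_scope.

Inductive scalar_kind := RealScalars | ComplexScalars.

Definition scalar_field (R : realType) (s : scalar_kind) : numFieldType :=
  match s with RealScalars => R | ComplexScalars => R[i] end.

Definition scalar_conj (R : realType) (s : scalar_kind) :
    {rmorphism scalar_field R s -> scalar_field R s} :=
  match s with
  | RealScalars => (idfun : {rmorphism R -> R})
  | ComplexScalars => (Num.conj : {rmorphism R[i] -> R[i]})
  end.

Definition scalar_of_real (R : realType) (s : scalar_kind) :
    {rmorphism R -> scalar_field R s} :=
  match s with
  | RealScalars => (idfun : {rmorphism R -> R})
  | ComplexScalars => (real_complex R : {rmorphism R -> R[i]})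
  end.

Definition scalar_re (R : realType) (s : scalar_kind) : scalar_field R s -> R :=
  match s with
  | RealScalars => idfun
  | ComplexScalars => @complex.Re R
  end.

Section InnerProduct.
Variables (R : realType) (s : scalar_kind) (Y : vectType (scalar_field R s)).
Variable h : Y -> Y -> scalar_field R s.

Definition ip_norm (v : Y) : R := Num.sqrt (scalar_re (h v v)).

(* [L] and [M] are meant to be lines; [vpick L] is then some nonzero vector of
   [L] (for the Grassmann algebra, see [fubini_study_line] below). *)
Definition fubini_study (L M : {vspace Y}) : R :=
  acos (scalar_re `|h (vpick L) (vpick M)| / (ip_norm (vpick L) * ip_norm (vpick M))).

End InnerProduct.

Section Angles.
Variables (R : realType) (s : scalar_kind) (X : vectType (scalar_field R s)).
Variable form : {dot X for scalar_conj R s}.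
Implicit Types V W : {vspace X}.

(* [form] is linear in its left entry and conjugate-linear in its right entry;
   [ip] has the opposite convention. *)
Definition ip (v w : X) : scalar_field R s := form w v.

Definition is_principal_angles V W
    (theta : (minn (\dim V) (\dim W)).-tuple R) : Prop :=
  [/\ sorted <=%R theta,
      {in theta, forall t, 0 <= t <= pi / 2} &
      exists (e : (\dim V).-tuple X) (f : (\dim W).-tuple X),
        [/\ basis_of V e /\ orthonormal form e,
            basis_of W f /\ orthonormal form f &
            forall (i : 'I_(\dim V)) (j : 'I_(\dim W)),
              ip (tnth e i) (tnth f j) =
                if i == j :> nat then scalar_of_real R s (cos theta`_i) else 0]].

(* Principal angles exist and are unique, so the choice made by [xget] is
   immaterial. *)
Definition principal_angles V W : (minn (\dim V) (\dim W)).-tuple R :=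
  xget [tuple of nseq _ 0] (is_principal_angles (V := V) (W := W)).

(* The first two cases are the conventions for {0}. *)
Definition grassmann_angle V W : R :=
  if V == 0%VS then 0
  else if W == 0%VS then pi / 2
  else if (\dim V <= \dim W)%N
       then acos (\prod_(t <- principal_angles V W) cos t)
       else pi / 2.

Definition grassmann_angle_max V W : R :=
  Num.max (grassmann_angle V W) (grassmann_angle W V).

End Angles.

(* The Grassmann algebra, as the free module on the products
   e_I = e_{i_1} /\ ... /\ e_{i_p}, I = {i_1 < ... < i_p}, of vectors of the
   basis [vbasis fullv] of X; the degree of e_I is #|I|. *)
Section GrassmannAlgebra.
Variables (R : realType) (s : scalar_kind) (X : vectType (scalar_field R s)).
Local Notation K := (scalar_field R s).
Local Notation n := (\dim {:X}).
Local Notation bX := (vbasis {:X}).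

Definition ext := {ffun {set 'I_n} -> K^o}.
HB.instance Definition _ := Vector.on ext.

Definition inversions (I J : {set 'I_n}) : nat :=
  #|[set p : 'I_n * 'I_n | [&& p.1 \in I, p.2 \in J & (p.2 < p.1)%N]]|.

(* e_I /\ e_J is (-1)^(inversions I J) e_(I :|: J) if I, J are disjoint,
   and 0 otherwise. *)
Definition wedge (u v : ext) : ext :=
  [ffun S : {set 'I_n} => \sum_(I : {set 'I_n} | I \subset S)
     (-1) ^+ inversions I (S :\: I) * u I * v (S :\: I) : K^o].

Definition ext_one : ext := [ffun S : {set 'I_n} => (S == finset.set0)%:R : K^o].

Definition ext_of_vec (x : X) : ext :=
  [ffun S : {set 'I_n} => \sum_(i | S == [set i]%SET) coord bX i x : K^o].

(* v_1 /\ ... /\ v_p; it is 1 when p = 0 *)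
Definition blade (vs : seq X) : ext :=
  foldr (fun x w => wedge (ext_of_vec x) w) ext_one vs.

(* Lambda^k U, as a subspace of Lambda X *)
Definition ext_power (k : nat) (U : {vspace X}) : {vspace ext} :=
  <<[seq blade [seq tnth (vbasis U) i | i <- t] | t : k.-tuple 'I_(\dim U)]>>%VS.

Definition pluecker (U : {vspace X}) : {vspace ext} := ext_power (\dim U) U.

Variable form : {dot X for scalar_conj R s}.

(* the intended value of <v_1 /\ ... /\ v_p, w_1 /\ ... /\ w_q>; [ext_ip] is its
   sesquilinear extension from the basis (e_I) *)
Definition blade_ip (vs ws : seq X) : K :=
  if size vs == size ws
  then \det (\matrix_(i < size vs, j < size vs) ip form vs`_i ws`_j)
  else 0.

Definition basis_vectors (I : {set 'I_n}) : seq X :=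
  [seq tnth bX i | i <- enum I].

Definition ext_ip (u v : ext) : K :=
  \sum_I \sum_J
    scalar_conj R s (u I) * v J * blade_ip (basis_vectors I) (basis_vectors J).

Definition dFS (V W : {vspace X}) : R :=
  fubini_study ext_ip (pluecker V) (pluecker W).

End GrassmannAlgebra.

Section Facts.
Variables (R : realType) (s : scalar_kind) (X : vectType (scalar_field R s)).
Local Notation K := (scalar_field R s).
Local Notation n := (\dim {:X}).
Local Notation bX := (vbasis {:X}).
Implicit Types (S T : {set 'I_n}) (i j : 'I_n).

Lemma wedge_ext_of_vec (x : X) (w : ext X) S :
  wedge (ext_of_vec x) w S =
  \sum_(i in S) (-1) ^+ #|[set j in S :\ i | (j < i)%N]| * coord bX i x * w (S :\ i).
Proof.
rewrite ffunE.
under eq_bigr => I _.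
  rewrite ffunE [X in _ * X * _]big_mkcond mulr_sumr mulr_suml.
  over.
rewrite exchange_big /= [RHS]big_mkcond /=.
apply: eq_bigr => i _.
case: ifP => iS; last first.
  rewrite big1 // => I sIS; case: eqP => [eI|]; last by rewrite mulr0 mul0r.
  by move: sIS; rewrite eI finset.sub1set iS.
rewrite (bigD1 [set i]%SET) ?finset.sub1set //= eqxx big1 ?addr0; last first.
  by move=> I /andP[_ /negPf->]; rewrite mulr0 mul0r.
congr (_ ^+ _ * _ * _).
rewrite /inversions -(card_imset (mem [set j in S :\ i | (j < i)%N])
  (f := fun j => (i, j))); last by move=> ? ? [].
apply: eq_card => -[a b]; rewrite !inE /=; apply/idP/imsetP => [/and3P[/eqP-> ? ?]|[c]].
  by exists b => //; rewrite !inE; apply/andP.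
rewrite !inE => /andP[c1 c2] [-> ->]; rewrite eqxx /=.
by rewrite c1 c2.
Qed.

Lemma enum_setU1_split i T : i \notin T ->
  exists l r : seq 'I_n, [/\ enum T = l ++ r, enum (i |: T)%SET = l ++ i :: r &
    size l = #|[set j in T | (j < i)%N]|].
Proof.
move=> iT.
have enumE (U : {set 'I_n}) : enum U = [seq j <- enum 'I_n | j \in U].
  by rewrite [in RHS]enumT.
pose A := take i (enum 'I_n); pose B := drop i.+1 (enum 'I_n).
have eAB : enum 'I_n = A ++ i :: B.
  rewrite -[LHS](cat_take_drop i) (drop_nth i) ?size_enum_ord //.
  by rewrite nth_ord_enum.
have mA j : j \in A -> (j < i)%N.
  rewrite /A -[_ \in _](mem_map val_inj) map_take val_enum_ord take_iota.
  by rewrite mem_iota /= add0n leq_min => /andP[].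
have mB j : j \in B -> (i < j)%N.
  rewrite /B -[_ \in _](mem_map val_inj) map_drop val_enum_ord drop_iota.
  by rewrite mem_iota => /andP[].
exists [seq j <- A | j \in T], [seq j <- B | j \in T]; split.
- rewrite enumE eAB filter_cat /= (negPf iT) //.
- rewrite enumE eAB filter_cat /= !inE eqxx /=.
  congr (_ ++ _ :: _); apply: eq_in_filter => j; rewrite !inE.
    by move/mA; case: eqVneq => [->|//]; rewrite ltnn.
  by move/mB; case: eqVneq => [->|//]; rewrite ltnn.
- rewrite cardE enumE eAB filter_cat /= size_cat /= !inE ltnn andbF.
  rewrite [X in (_ + size X)%N](_ : _ = [::]) ?addn0; last first.
    rewrite -(filter_pred0 B); apply: eq_in_filter => j /mB ij; rewrite !inE.
    by rewrite ltnNge (ltnW ij) andbF.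
  by congr size; apply: eq_in_filter => j /mA ij; rewrite !inE ij andbT.
Qed.

Section Universal.
Variable F : seq X -> K.
Hypothesis F_lin : forall (l r : seq X) (a : K) (x y : X),
  F (l ++ (a *: x + y) :: r) = a * F (l ++ x :: r) + F (l ++ y :: r).
Hypothesis F_alt : forall l, ~~ uniq l -> F l = 0.

Lemma alternating_swap l r x y : F (l ++ x :: y :: r) = - F (l ++ y :: x :: r).
Proof.
have alt z : F (l ++ z :: z :: r) = 0.
  by apply: F_alt; rewrite cat_uniq /= inE eqxx /= !andbF.
have addF (l1 r1 : seq X) (a b : X) : F (l1 ++ (a + b) :: r1) = F (l1 ++ a :: r1) + F (l1 ++ b :: r1).
  by rewrite -{1}[a]scale1r F_lin mul1r.
have := alt (x + y); rewrite addF -(cat_rcons x l) -(cat_rcons y l) !addF !cat_rcons.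
by rewrite !alt add0r addr0 => /eqP; rewrite addr_eq0 => /eqP.
Qed.

Lemma alternating_move l r x : forall p, F (p ++ x :: l ++ r) =
  (-1) ^+ size l * F (p ++ l ++ x :: r).
Proof.
elim: l => [|y l IH] p /=; first by rewrite mul1r.
by rewrite alternating_swap -cat_rcons IH cat_rcons exprS mulN1r mulNr.
Qed.

Lemma multilinear_sum (I : eqType) (t : seq I) (c : I -> K) (v : I -> X) l r :
  F (l ++ \sum_(k <- t) c k *: v k :: r) = \sum_(k <- t) c k * F (l ++ v k :: r).
Proof.
elim: t => [|k t IH]; last by rewrite !big_cons F_lin IH.
rewrite !big_nil; apply: (addrI (F (l ++ 0 :: r))); rewrite addr0.
by rewrite -{1}[F _]mul1r -F_lin scale1r addr0.
Qed.

Lemma multilinear_alternating_blade vs : forall l,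
  \sum_S blade vs S * F (l ++ basis_vectors S) = F (l ++ vs).
Proof.
elim: vs => [|v vs IH] l.
  rewrite (bigD1 finset.set0) //= ffunE eqxx mul1r /basis_vectors enum_set0 /=.
  by rewrite big1 ?addr0 // => S /negPf nS; rewrite ffunE nS mul0r.
rewrite /= -cat_rcons -IH.
under eq_bigr do rewrite wedge_ext_of_vec mulr_suml.
rewrite (exchange_big_dep predT) //=.
transitivity (\sum_i \sum_(T : {set 'I_n} | i \notin T)
  (coord bX i v * blade vs T * F (l ++ tnth bX i :: basis_vectors T))).
  apply: eq_bigr => i _.
  rewrite (reindex_onto (fun T => i |: T)%SET (fun S => S :\ i)); last first.
    by move=> S; exact: finset.setD1K.
  apply: eq_big => [T|T].
    rewrite !inE eqxx /=; apply/eqP/idP => [<-|]; last exact: finset.setU1K.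
    by rewrite !inE eqxx.
  rewrite !inE eqxx /= => /eqP eT; rewrite eT.
  have iT : i \notin T by rewrite -eT !inE eqxx.
  have [a [b [e1 e2 sz]]] := enum_setU1_split iT.
  rewrite /basis_vectors e1 e2 !map_cat /= alternating_move size_map sz.
  by rewrite [RHS]mulrCA !mulrA.
rewrite (exchange_big_dep predT) //=; apply: eq_bigr => T _.
rewrite [LHS]big_mkcond /=.
rewrite cat_rcons {2}(coord_vbasis (memvf v)).
rewrite multilinear_sum big_distrr /=; apply: eq_bigr => i _.
rewrite (tnth_nth 0) /=.
case: ifP => [_|/negbFE iT]; first by rewrite mulrCA mulrA.
rewrite F_alt ?mulr0 //.
rewrite cat_uniq /= negb_and negb_and negb_and negbK.
by rewrite -(tnth_nth 0) map_f ?orbT // mem_enum.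
Qed.

End Universal.

Variable form : {dot X for scalar_conj R s}.

Lemma scalar_conjK : involutive (scalar_conj R s).
Proof. by case: s => //= x; exact: conjCK. Qed.

Lemma ip_conj v w : ip form w v = scalar_conj R s (ip form v w).
Proof. by rewrite /ip hermC /= mul1r. Qed.

Lemma blade_ip_conj vs ws :
  blade_ip form ws vs = scalar_conj R s (blade_ip form vs ws).
Proof.
rewrite /blade_ip eq_sym; case: eqP => [e|_]; last by rewrite rmorph0.
rewrite -det_map_mx -det_tr -e; congr (\det _).
by apply/matrixP => i j; rewrite !mxE ip_conj.
Qed.

Lemma blade_ip_lin vs (l r : seq X) (a : K) (x y : X) :
  blade_ip form vs (l ++ (a *: x + y) :: r) =
  a * blade_ip form vs (l ++ x :: r) + blade_ip form vs (l ++ y :: r).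
Proof.
rewrite /blade_ip !size_cat /=; case: eqP => [e|_]; last by rewrite mulr0 addr0.
have i0P : (size l < size vs)%N by rewrite e addnS ltnS leq_addr.
rewrite -det_tr -[X in _ = a * X + _]det_tr -[X in _ = _ + X]det_tr.
rewrite -[X in _ = _ + X]mul1r.
apply: (determinant_multilinear (i0 := Ordinal i0P)).
- apply/rowP => j; rewrite !mxE /= !nth_cat ltnn subnn /= mul1r /ip.
  by rewrite linearDl linearZl_LR.
- apply/matrixP => i j; rewrite !mxE !nth_cat.
  case: ltnP => // h; case E: (_ - _)%N => [|k] //=.
  have /eqP := neq_lift (Ordinal i0P) i; case; apply: val_inj => /=.
  by apply/eqP; rewrite eqn_leq h /= -subn_eq0 E.
- apply/matrixP => i j; rewrite !mxE !nth_cat.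
  case: ltnP => // h; case E: (_ - _)%N => [|k] //=.
  have /eqP := neq_lift (Ordinal i0P) i; case; apply: val_inj => /=.
  by apply/eqP; rewrite eqn_leq h /= -subn_eq0 E.
Qed.

Lemma blade_ip_alt vs (ws : seq X) : ~~ uniq ws -> blade_ip form vs ws = 0.
Proof.
rewrite /blade_ip; case: eqP => [e|//] /(uniqPn 0)[i [j [ij jw eij]]].
have jP : (j < size vs)%N by rewrite e.
have iP : (i < size vs)%N := ltn_trans ij jP.
rewrite -det_tr.
apply: (determinant_alternate (i1 := Ordinal iP) (i2 := Ordinal jP)).
  by rewrite -val_eqE /= ltn_eqF.
by move=> k; rewrite !mxE /= eij.
Qed.

(* The formula <v_1 /\ ... /\ v_p, w_1 /\ ... /\ w_p> = det(<v_i, w_j>), and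
   the orthogonality of distinct degrees. *)
Lemma ext_ip_blade (vs ws : seq X) :
  ext_ip form (blade vs) (blade ws) = blade_ip form vs ws.
Proof.
have U us ts := multilinear_alternating_blade (@blade_ip_lin us) (@blade_ip_alt us) ts [::].
rewrite blade_ip_conj -U rmorph_sum /ext_ip /=; apply: eq_bigr => I _.
rewrite rmorphM -blade_ip_conj -U big_distrr /=.
by apply: eq_bigr => J _; rewrite mulrA.
Qed.


Lemma extZD (a : K) (u v : ext X) S : (a *: u + v) S = a * u S + v S.
Proof. by rewrite ffunE ffunE. Qed.

Lemma blade_lin (l r : seq X) (a : K) (x y : X) :
  blade (l ++ (a *: x + y) :: r) = a *: blade (l ++ x :: r) + blade (l ++ y :: r).
Proof.
elim: l => [|z l IH] /=; apply/ffunP => S.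
  rewrite [RHS]extZD !wedge_ext_of_vec big_distrr -big_split /=.
  apply: eq_bigr => i _; rewrite linearP /= mulrDr mulrDl; congr (_ + _).
  by rewrite [in LHS]mulrCA -!mulrA.
rewrite IH [RHS]extZD !wedge_ext_of_vec big_distrr -big_split /=.
apply: eq_bigr => i _; rewrite extZD mulrDr; congr (_ + _).
exact: mulrCA.
Qed.

(* [ext_power k U] is the span of all the products u_1 /\ ... /\ u_k, u_i \in U *)
Lemma blade_ext_power (U : {vspace X}) (us : seq X) :
  {subset us <= U} -> blade us \in ext_power (size us) U.
Proof.
have key (us1 : seq X) (t : seq 'I_(\dim U)) : {subset us1 <= U} ->
  blade ([seq tnth (vbasis U) k | k <- t] ++ us1) \in ext_power (size t + size us1) U.
  elim: us1 t => [|u us1 IH] t sU.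
    rewrite cats0 addn0; apply: memv_span; apply/mapP.
    by exists (in_tuple t); rewrite ?mem_enum.
  have uU : u \in U by apply: sU; rewrite mem_head.
  rewrite (coord_vbasis uU).
  elim/big_rec: _ => [|k y _ IHy].
    rewrite -(subrr (0 : X)) -scaleN1r addrC blade_lin.
    set b := blade _; have -> : -1 *: b + b = 0 by rewrite scaleN1r addNr.
    exact: mem0v.
  rewrite blade_lin memvD // memvZ // -tnth_nth -cat_rcons -map_rcons.
  rewrite -addSnnS -(size_rcons t k); apply: IH => z zu; apply: sU.
  by rewrite inE zu orbT.
by move=> sU; exact: (key us [::]).
Qed.

Lemma scalar_normE (x : K) : `|x| = scalar_of_real R s (scalar_re `|x|).
Proof. by case: s x => //= x; rewrite normc_def. Qed.

Lemma scalar_re_of_realM (c : R) (x : K) :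
  scalar_re (scalar_of_real R s c * x) = c * scalar_re x.
Proof. by case: s x => //= -[a b] /=; rewrite mul0r subr0. Qed.

Lemma scalar_re_normM (x y : K) :
  scalar_re `|x * y| = scalar_re `|x| * scalar_re `|y|.
Proof. by rewrite normrM [in LHS]scalar_normE scalar_re_of_realM. Qed.

Lemma scalar_norm_conj (x : K) : `|scalar_conj R s x| = `|x|.
Proof. by case: s x => //= x; rewrite norm_conjC. Qed.

Lemma scalar_re_norm_ge0 (x : K) : 0 <= scalar_re `|x|.
Proof. by case: s x => [x|[a b]]; [exact: normr_ge0 | exact: sqrtr_ge0]. Qed.

Lemma scalar_re_norm_gt0 (x : K) : (0 < scalar_re `|x|) = (x != 0).
Proof.
rewrite lt_def scalar_re_norm_ge0 andbT; congr negb.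
by rewrite -[RHS]normr_eq0 [in RHS]scalar_normE fmorph_eq0.
Qed.

Lemma scalar_re_conjM (a x : K) :
  scalar_re (scalar_conj R s a * a * x) = scalar_re `|a| ^+ 2 * scalar_re x.
Proof.
have -> : scalar_conj R s a * a = scalar_of_real R s (scalar_re `|a| ^+ 2).
  rewrite rmorphXn /= -scalar_normE mulrC.
  by case: s a => /= a; [rewrite real_normK ?num_real | rewrite normCK].
exact: scalar_re_of_realM.
Qed.

Lemma fubini_study_line (v w : ext X) : v != 0 -> w != 0 ->
  fubini_study (ext_ip form) <[v]> <[w]> =
  acos (scalar_re `|ext_ip form v w| /
        (ip_norm (ext_ip form) v * ip_norm (ext_ip form) w)).
Proof.
have ZZ a b (x y : ext X) : ext_ip form (a *: x) (b *: y) =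
    scalar_conj R s a * b * ext_ip form x y.
  rewrite /ext_ip big_distrr; apply: eq_bigr => I _.
  rewrite big_distrr; apply: eq_bigr => J _.
  have E (c : K) (u : ext X) S : (c *: u) S = c * u S by rewrite ffunE.
  rewrite !E /= rmorphM.
  by rewrite !mulrA; congr (_ * _ * _); exact: mulrAC.
have pick (x : ext X) : x != 0 ->
    exists2 a, 0 < scalar_re `|a : K| & vpick <[x]>%VS = a *: x.
  move=> x0; have /vlineP[a Ea] := memv_pick <[x]>%VS; exists a => //.
  rewrite scalar_re_norm_gt0; apply: contra x0 => /eqP a0.
  by move/eqP: Ea; rewrite a0 scale0r vpick0 -dimv_eq0 dim_vline; case: (x == 0).
have normZ a (x : ext X) : ip_norm (ext_ip form) (a *: x) =
    scalar_re `|a| * ip_norm (ext_ip form) x.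
  rewrite /ip_norm ZZ scalar_re_conjM sqrtrM ?sqr_ge0 // sqrtr_sqr ger0_norm //.
  exact: scalar_re_norm_ge0.
move=> /pick[a a0 Ea] /pick[b b0 Eb].
rewrite /fubini_study Ea Eb ZZ !normZ !scalar_re_normM scalar_norm_conj.
congr acos; rewrite mulrACA -mulf_div divff ?mul1r //.
by rewrite mulf_neq0 // gt_eqF.
Qed.

End Facts.

(* Main.v *)
Require Import Defs.
From mathcomp Require Import all_boot all_order all_algebra.
From mathcomp Require Import perm complex.
From mathcomp Require Import all_classical all_reals trigo.

(** Both sides are computed from orthonormal bases [e] of [V] and [f] of [W].

    On the Fubini-Study side, the coordinates of a product u_1 /\ ... /\ u_p on
    the basis (e_I) of the Grassmann algebra are the p x p minors of the matrix
    of coordinates of the u_i ([blade_coord]). As the determinant is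
    multiplicative, two p-tuples related by a square matrix A have products
    related by the scalar det A ([blade_linear_combination]), so Lambda^p V is
    the line spanned by the product of any basis of V ([pluecker_line]). For
    orthonormal bases these products are unit vectors, and d_FS(V, W) is the
    arccosine of |det <e_i, f_j>| when the dimensions agree, and of 0 when they
    differ ([dFS_orthonormal]).

    On the angle side, if dim V = dim W and the bases are principal ones, then
    the matrix <e_i, f_j> is diagonal with entries cos theta_i, so that its
    determinant is the product of cosines that defines the Grassmann angle
    ([blade_ip_principal]); since d_FS is symmetric, both Grassmann angles agree
    with it. If dim V <> dim W, one of the two Grassmann angles is pi / 2 by
    convention, the other is at most pi / 2, and d_FS is arccos 0 = pi / 2.

    What remains is that principal bases exist when dim V = dim W
    ([exists_principal_angles]), a singular value decomposition, obtained by
    induction on the dimension. If N = (<f_j, e_i>) is the matrix of the pairing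
    in orthonormal bases, an eigenvector of N N^* (available over C because C is
    algebraically closed, over R because the matrix is symmetric) gives unit
    vectors v in V and w in W such that the inner products with v are c times
    those with w on all of W, and conversely on all of V, for some c in [0, 1]
    ([unit_singular_vector_pair]). The pairing then splits along v, w and their
    orthogonal complements in V and W. *)

Set Implicit Arguments.
Unset Strict Implicit.
Unset Printing Implicit Defensive.

Import Order.TTheory GRing.Theory Num.Theory.

Local Open Scope ring_scope.

(** * Scalars *)

Section Scalars.
Variables (R : realType) (s : scalar_kind).
Local Notation K := (scalar_field R s).
Local Notation conj := (scalar_conj R s).
Local Notation of_real := (scalar_of_real R s).

Lemma scalar_ge0E (x : K) : 0 <= x -> x = of_real (scalar_re x).
Proof.
by move=> x0; rewrite -{1}(ger0_norm x0) scalar_normE (ger0_norm x0).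
Qed.

Lemma scalar_of_real_ge0 (a : R) : (0 <= of_real a) = (0 <= a).
Proof. by case: s => //=; rewrite ler0c. Qed.

Lemma scalar_conj_of_real (a : R) : conj (of_real a) = of_real a.
Proof. by case: s => //=; rewrite conj_Creal // complex_real. Qed.

Lemma scalar_re_norm_of_real (a : R) : 0 <= a -> scalar_re `|of_real a| = a.
Proof.
move=> a0; apply: (fmorph_inj of_real); rewrite -scalar_normE ger0_norm //.
by rewrite scalar_of_real_ge0.
Qed.

Lemma scalar_normCK (a : K) : a * conj a = `|a| ^+ 2.
Proof.
by case: s a => /= a; [rewrite real_normK ?num_real | rewrite normCK].
Qed.

End Scalars.

(** * Eigenvalues of N N^* *)

(** A complex eigenvalue [a] of [A], with eigenvector z, exists and is real:
    with w = conj z, moving A from z to w in z A w^T turns a |z|^2 into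
    conj a |z|^2. A real root of the characteristic polynomial is
    a real eigenvalue. *)
Lemma real_symmetric_eigenvalue (R : realType) n (A : 'M[R]_n) :
  (0 < n)%N -> A^T = A -> exists a, eigenvalue A a.
Proof.
move=> n0 At; pose B := map_mx (real_complex R) A.
have [a aB] := eigenvalue_closed B n0.
have /eigenvalueP[z zB z0] := aB.
pose w := map_mx Num.conj z.
have wB : w *m B = a^* *: w.
  rewrite -map_mxZ -zB map_mxM; congr (_ *m _).
  by apply/matrixP => i j; rewrite !mxE /= conj_Creal // complex_real.
have zw0 : (z *m w^T) 0 0 != 0.
  apply: contra z0 => /eqP; rewrite mxE.
  under eq_bigr do rewrite !mxE -normCK.
  move=> /psumr_eq0P zw; apply/eqP/rowP => i; rewrite mxE.
  have /eqP := zw (fun j _ => exprn_ge0 2 (normr_ge0 (z 0 j))) i isT.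
  by rewrite sqrf_eq0 normr_eq0 => /eqP.
have ar : a^* = a.
  apply: (mulIf zw0).
  have -> : a * (z *m w^T) 0 0 = (z *m B *m w^T) 0 0.
    by rewrite zB -scalemxAl [RHS]mxE.
  have -> : a^* * (z *m w^T) 0 0 = (z *m (w *m B)^T) 0 0.
    by rewrite wB linearZ /= -scalemxAr [RHS]mxE.
  by rewrite trmx_mul map_trmx At mulmxA.
have /complex_realP[r ra] : a \is Num.real by apply/CrealP.
exists r; rewrite eigenvalue_root_char.
by move: aB; rewrite eigenvalue_root_char ra -map_char_poly fmorph_root.
Qed.

Section SingularRowPair.
Variables (R : realType) (s : scalar_kind).
Local Notation K := (scalar_field R s).
Local Notation conj := (scalar_conj R s).

Lemma gram_eigenvalue n (N : 'M[K]_n) : (0 < n)%N ->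
  exists a, eigenvalue (N *m map_mx conj N^T) a.
Proof.
case: s N => N n0; last exact: (@eigenvalue_closed (R[i] : numClosedFieldType)).
apply: real_symmetric_eigenvalue => //.
by rewrite trmx_mul !map_mx_id // trmxK.
Qed.

(** If a is an eigenvector of N N^*, then b = a N works unless a N = 0; in that
    case N, hence N^*, is singular, and b is taken in the kernel of N^*. *)
Lemma singular_row_pair n (N : 'M[K]_n) : (0 < n)%N ->
  exists (a b : 'rV[K]_n) (c d : K), [/\ a != 0, b != 0,
    a *m N = c *: b & b *m map_mx conj N^T = d *: a].
Proof.
move=> n0; have [d /eigenvalueP[a aN a0]] := gram_eigenvalue N n0.
have [aN0|aN0] := eqVneq (a *m N) 0; last first.
  by exists a, (a *m N), 1, d; rewrite scale1r -mulmxA.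
have dN : \det (map_mx conj N^T) == 0.
  rewrite det_map_mx det_tr fmorph_eq0; apply/det0P.
  by exists a.
have /det0P[b b0 bN] := dN.
by exists a, b, 0, 0; rewrite !scale0r.
Qed.

End SingularRowPair.

(** * Orthonormal families *)

Section Orthonormal.
Variables (R : realType) (s : scalar_kind) (X : vectType (scalar_field R s)).
Variable form : {dot X for scalar_conj R s}.
Local Notation K := (scalar_field R s).
Local Notation conj := (scalar_conj R s).
Local Notation of_real := (scalar_of_real R s).
Implicit Types (U V W : {vspace X}) (e f : seq X).

Lemma dot_conj v w : form v w = conj (form w v).
Proof. by rewrite hermC mul1r. Qed.

Lemma orthonormal_nthP e :
  reflect (forall i j, (i < size e)%N -> (j < size e)%N ->
             form e`_i e`_j = (i == j)%:R) (orthonormal form e).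
Proof.
apply: (iffP andP) => [[]|H].
  elim: e => [|v e IH] //= /andP[/eqP v1 e1] /andP[/andP[/allP ve _] oe].
  move=> [|i] [|j] //=.
  - by move=> _; rewrite ltnS => jl; have /eqP := ve _ (mem_nth 0 jl).
  - rewrite ltnS => il _; rewrite dot_conj; have /eqP := ve _ (mem_nth 0 il).
    by rewrite /= => ->; rewrite rmorph0.
  - by rewrite !ltnS eqSS; exact: IH.
elim: e H => [|v e IH] // H.
have [|IH1 IH2] := IH; first by move=> i j il jl; apply: (H i.+1 j.+1).
split=> /=; [by rewrite (H 0 0)%N //= eqxx IH1|].
rewrite IH2 !andbT; apply/allP => w /(nthP 0)[j jl <-] /=.
by rewrite (H 0 j.+1)%N.
Qed.

Lemma free_orthonormal e : orthonormal form e -> free e.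
Proof.
move=> /orthonormal_nthP oe; rewrite -[e]in_tupleE; apply/freeP => k k0 i.
have /(congr1 (form^~ e`_i)) := k0.
rewrite linear0l linear_sumlz (bigD1 i) //= big1 => [|j ji].
  by rewrite addr0 linearZl_LR /= oe ?ltn_ord // eqxx mulr1.
by rewrite linearZl_LR /= oe ?ltn_ord // (negPf (ji : (j : nat) != i)) mulr0.
Qed.

Lemma orthonormal_basis_of e U : orthonormal form e -> {subset e <= U} ->
  size e = \dim U -> basis_of U e.
Proof.
move=> oe eU sz; rewrite basisEfree free_orthonormal // sz leqnn andbT /=.
exact/span_subvP.
Qed.

Lemma dot_ge0 v : 0 <= form v v.
Proof.
have [->|/neq0_dnorm_gt0/ltW //] := eqVneq v 0.
by rewrite linear0l.
Qed.

Lemma dot_normE v : form v v = of_real (scalar_re (form v v)).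
Proof. exact/scalar_ge0E/dot_ge0. Qed.

Lemma dot_norm_gt0 v : v != 0 -> 0 < scalar_re (form v v).
Proof.
move=> v0; have : 0 < form v v by exact: neq0_dnorm_gt0.
by rewrite {1}dot_normE lt_def scalar_of_real_ge0 fmorph_eq0 -lt_def.
Qed.

Lemma exists_unit_multiple v : v != 0 ->
  exists c : R, form (of_real c *: v) (of_real c *: v) = 1.
Proof.
move=> v0; pose c := Num.sqrt (scalar_re (form v v)).
have c0 : c != 0 by rewrite gt_eqF // sqrtr_gt0 dot_norm_gt0.
exists c^-1.
rewrite linearZl_LR linearZr_LR /= scalar_conj_of_real dot_normE -!rmorphM /=.
by rewrite -(sqr_sqrtr (ltW (dot_norm_gt0 v0))) -/c expr2 mulKf ?mulVf ?rmorph1.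
Qed.

Lemma dim_orthogonal_slice U v : v \in U -> form v v = 1 ->
  \dim U = (\dim (U :&: orthov form <[v]>)).+1.
Proof.
move=> vU v1; have vN : v \notin orthov form U.
  by apply/mem_orthovPn; exists v => //; rewrite (_ : _ v v = 1) ?oner_eq0.
rewrite -eq_dim_orthov1 // prednK // lt0n dimv_eq0.
by apply: contraNneq vN => ->; rewrite orthov0 memvf.
Qed.

Lemma orthonormal_slice_cons U v e : form v v = 1 ->
  {subset e <= (U :&: orthov form <[v]>)%VS} -> orthonormal form e ->
  orthonormal form (v :: e).
Proof.
move=> v1 eU /andP[oe1 oe2]; rewrite /orthonormal /= v1 eqxx oe1 oe2 !andbT /=.
apply/allP => w /eU; rewrite memv_cap mem_orthov1 => /andP[_ /eqP wv].
by rewrite /= dot_conj wv rmorph0.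
Qed.

Lemma exists_orthonormal_seq U : exists e, [/\ size e = \dim U,
  orthonormal form e & {subset e <= U}].
Proof.
move dU: (\dim U) => n; elim: n U dU => [|n IH] U dU.
  by exists [::]; split.
have v0 : vpick U != 0 by rewrite vpick0 -dimv_eq0 dU.
have [c v1] := exists_unit_multiple v0; set v := _ *: _ in v1.
have vU : v \in U by rewrite memvZ // memv_pick.
have [e [sz oe eU]] : exists e, [/\ size e = n, orthonormal form e &
    {subset e <= (U :&: orthov form <[v]>)%VS}].
  by apply: IH; apply/eqP; rewrite -eqSS -(dim_orthogonal_slice vU v1) dU.
exists (v :: e); split; rewrite /= ?sz ?(orthonormal_slice_cons v1 eU) //.
by move=> x; rewrite inE => /predU1P[-> //|/eU]; rewrite memv_cap => /andP[].
Qed.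

Lemma exists_orthonormal_basis U :
  exists e, basis_of U e /\ orthonormal form e.
Proof.
have [e [sz oe eU]] := exists_orthonormal_seq U.
by exists e; split=> //; apply: orthonormal_basis_of.
Qed.

End Orthonormal.

(** * Singular vectors and principal angles *)

Section PrincipalAngles.
Variables (R : realType) (s : scalar_kind) (X : vectType (scalar_field R s)).
Variable form : {dot X for scalar_conj R s}.
Local Notation K := (scalar_field R s).
Local Notation conj := (scalar_conj R s).
Local Notation of_real := (scalar_of_real R s).
Implicit Types (U V W : {vspace X}) (e f : seq X).

Lemma orthogonal_to_basis W f u : basis_of W f ->
  (forall j, (j < size f)%N -> form u f`_j = 0) ->
  {in W, forall y, form u y = 0}.
Proof.
move=> bf uf y yW; rewrite -[f]in_tupleE in bf; rewrite (coord_basis bf yW).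
by rewrite linear_sumr big1 // => i _; rewrite linearZr_LR /= uf ?mulr0.
Qed.

Lemma orthonormal_coord e n (a : 'rV[K]_n) (k : 'I_n) : orthonormal form e ->
  size e = n -> form (\sum_i a 0 i *: e`_i) e`_k = a 0 k.
Proof.
move=> /orthonormal_nthP oe sz.
rewrite linear_sumlz (bigD1 k) //= big1 => [|i ik].
  by rewrite linearZl_LR /= oe ?sz // eqxx mulr1 addr0.
by rewrite linearZl_LR /= oe ?sz // (negPf (ik : (i : nat) != k)) mulr0.
Qed.

(** Coordinate-free form of [singular_row_pair]: the restrictions to W of
    <., v> and <., w> are proportional, and so are their restrictions to V. In
    particular v is orthogonal to the complement of w in W, and w to the
    complement of v in V, which is what lets the induction proceed. *)
Lemma singular_vector_pair V W : \dim V = \dim W -> V != 0%VS ->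
  exists v w (c d : K),
    [/\ [/\ v \in V, w \in W, v != 0 & w != 0],
        {in W, forall y, form v y = c * form w y} &
        {in V, forall x, form w x = d * form v x}].
Proof.
move=> dVW V0; have n0 : (0 < \dim V)%N by rewrite lt0n dimv_eq0.
have [e [sze oe eV]] := exists_orthonormal_seq form V.
have [f [szf o_f fW]] := exists_orthonormal_seq form W.
have bV := orthonormal_basis_of oe eV sze.
have bW := orthonormal_basis_of o_f fW szf.
rewrite -dVW in szf; move: (\dim V) n0 sze szf => n n0 sze szf {dVW V0}.
pose N : 'M[K]_n := \matrix_(i, j) form e`_i f`_j.
have [a [b [c [d [a0 b0 aN bN]]]]] := singular_row_pair N n0.
pose v := \sum_i a 0 i *: e`_i; pose w := \sum_i b 0 i *: f`_i.
have ve k : form v e`_(k : 'I_n) = a 0 k by exact: orthonormal_coord.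
have wf k : form w f`_(k : 'I_n) = b 0 k by exact: orthonormal_coord.
exists v, w, c, d; split; first split.
- by apply: memv_suml => i _; rewrite memvZ // eV // mem_nth // sze.
- by apply: memv_suml => i _; rewrite memvZ // fW // mem_nth // szf.
- by apply: contra_neq a0 => v0; apply/rowP => k; rewrite -ve v0 linear0l mxE.
- by apply: contra_neq b0 => w0; apply/rowP => k; rewrite -wf w0 linear0l mxE.
- move=> y yW; apply/eqP; rewrite -subr_eq0 -linearZl_LR -linearBl; apply/eqP.
  apply: (orthogonal_to_basis bW _ yW) => j; rewrite szf => jn.
  rewrite linearBl linearZl_LR /= (wf (Ordinal jn)).
  have /rowP/(_ (Ordinal jn)) := aN; rewrite !mxE => <-.
  rewrite linear_sumlz; apply/eqP; rewrite subr_eq0; apply/eqP.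
  by apply: eq_bigr => i _; rewrite linearZl_LR mxE.
- move=> x xV; apply/eqP; rewrite -subr_eq0 -linearZl_LR -linearBl; apply/eqP.
  apply: (orthogonal_to_basis bV _ xV) => j; rewrite sze => jn.
  rewrite linearBl linearZl_LR /= (ve (Ordinal jn)).
  have /rowP/(_ (Ordinal jn)) := bN; rewrite !mxE => <-.
  rewrite linear_sumlz; apply/eqP; rewrite subr_eq0; apply/eqP.
  by apply: eq_bigr => i _; rewrite linearZl_LR !mxE -dot_conj.
Qed.

(** When b w is a unit vector, evaluating at y = b w determines the factor of
    proportionality, so both vectors can be rescaled without following how [k]
    changes. *)
Lemma proportional_functional W u w (k a b : K) :
    {in W, forall y, form u y = k * form w y} ->
    b *: w \in W -> form (b *: w) (b *: w) = 1 ->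
  {in W, forall y, form (a *: u) y = form (a *: u) (b *: w) * form (b *: w) y}.
Proof.
move=> uw wW w1 y yW; rewrite [form (a *: u) y]linearZl_LR /= uw //.
rewrite [form (a *: u) _]linearZl_LR /= uw //.
rewrite -[form w y in LHS]mul1r -w1 ![form (b *: w) _]linearZl_LR /=.
by rewrite -!mulrA; do 2 congr (_ * _); rewrite mulrCA.
Qed.

(** This is 0 <= |v - w|^2 = 2 - 2 c. *)
Lemma unit_cosine_le1 v w (c : R) : form v v = 1 -> form w w = 1 ->
  form v w = of_real c -> c <= 1.
Proof.
move=> v1 w1 vw; have := dot_ge0 form (v - w).
rewrite linearBl !linearBr /= v1 w1 (dot_conj form w) vw scalar_conj_of_real.
rewrite -(rmorph1 of_real) -!rmorphB /= scalar_of_real_ge0 opprB.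
by rewrite -mulr2n pmulrn_lge0 // subr_ge0.
Qed.

(** Normalising both vectors and rotating the phase of w makes their product a
    nonnegative real number, which is then the factor in both proportions. *)
Lemma unit_singular_vector_pair V W : \dim V = \dim W -> V != 0%VS ->
  exists v w (c : R),
    [/\ v \in V /\ form v v = 1, w \in W /\ form w w = 1, 0 <= c <= 1,
        {in W, forall y, form v y = of_real c * form w y} &
        {in V, forall x, form w x = of_real c * form v x}].
Proof.
move=> dVW V0.
have [v [w [k [l [[vV wW v0 w0] vy wx]]]]] := singular_vector_pair dVW V0.
have [a v1] := exists_unit_multiple form v0.
have [b w1] := exists_unit_multiple form w0.
pose z := form (of_real a *: v) (of_real b *: w).
(* p is the phase by which w has to be rotated: z / |z|, or 1 if z = 0 *)
have [p pz p1] : exists2 p : K, conj p * z = `|z| & p * conj p = 1.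
  have [->|z0] := eqVneq z 0.
    by exists 1; rewrite ?normr0 ?mulr0 // rmorph1 mulr1.
  exists (z / `|z|).
    rewrite rmorphM fmorphV mulrAC [conj z * _]mulrC scalar_normCK.
    rewrite [`|z|]scalar_normE scalar_conj_of_real -scalar_normE expr2 mulfK //.
    by rewrite normr_eq0.
  by rewrite scalar_normCK normrM normfV normr_id divff ?normr_eq0 // expr1n.
exists (of_real a *: v), ((p * of_real b) *: w), (scalar_re `|z|).
have vw :
    form (of_real a *: v) ((p * of_real b) *: w) = of_real (scalar_re `|z|).
  by rewrite -scalar_normE -pz -scalerA linearZr_LR.
have w1' : form ((p * of_real b) *: w) ((p * of_real b) *: w) = 1.
  by rewrite -scalerA linearZl_LR linearZr_LR /= w1 mulr1.
have wv :
    form ((p * of_real b) *: w) (of_real a *: v) = of_real (scalar_re `|z|).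
  by rewrite dot_conj vw scalar_conj_of_real.
split.
- by rewrite memvZ.
- by rewrite memvZ.
- by rewrite scalar_re_norm_ge0 (unit_cosine_le1 v1 w1' vw).
- by rewrite -vw; apply: (proportional_functional _ vy); rewrite ?memvZ.
- by rewrite -wv; apply: (proportional_functional _ wx); rewrite ?memvZ.
Qed.

(** The singular value decomposition of the pairing between [V] and [W], with
    the singular values in no particular order. *)
Lemma exists_biorthogonal_bases V W : \dim V = \dim W ->
  exists (e f : seq X) (c : seq R),
    [/\ [/\ size e = \dim V, orthonormal form e & {subset e <= V}],
        [/\ size f = \dim V, orthonormal form f & {subset f <= W}],
        size c = \dim V,
        {in c, forall t, 0 <= t <= 1} &
        forall i j, (i < \dim V)%N -> (j < \dim V)%N ->
          form f`_j e`_i = if i == j then of_real c`_i else 0].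
Proof.
move dV: (\dim V) => n; elim: n V W dV => [|n IH] V W dV dW.
  by exists [::], [::], [::].
have V0 : V != 0%VS by rewrite -dimv_eq0 dV.
have dVW : \dim V = \dim W by rewrite dV.
have [v [w [c [[vV v1] [wW w1] c01 vy wx]]]] :=
  unit_singular_vector_pair dVW V0.
have /eqP := dim_orthogonal_slice vV v1; rewrite dV eqSS eq_sym => /eqP dV'.
have /eqP := dim_orthogonal_slice wW w1; rewrite -dW eqSS => /eqP dW'.
have [e [f [cs [[sze oe eV] [szf o_f fW] szc cs01 ef]]]] := IH _ _ dV' dW'.
exists (v :: e), (w :: f), (c :: cs); split=> /=; rewrite ?sze ?szf ?szc //.
- split; rewrite ?(orthonormal_slice_cons v1 eV) //.
  by move=> x; rewrite inE => /predU1P[-> //|/eV]; rewrite memv_cap => /andP[].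
- split; rewrite ?(orthonormal_slice_cons w1 fW) //.
  by move=> x; rewrite inE => /predU1P[-> //|/fW]; rewrite memv_cap => /andP[].
- by move=> t; rewrite inE => /predU1P[-> //|/cs01].
move=> [|i] [|j] /=; rewrite ?ltnS => il jl.
- by rewrite wx // v1 mulr1.
- have /fW : f`_j \in f by rewrite mem_nth ?szf.
  rewrite memv_cap mem_orthov1 => /andP[fjW /eqP fj].
  rewrite dot_conj vy // (dot_conj form w) [form _ w]fj.
  by rewrite rmorph0 mulr0 rmorph0.
- have /eV : e`_i \in e by rewrite mem_nth ?sze.
  rewrite memv_cap mem_orthov1 => /andP[eiV /eqP ei].
  by rewrite wx // (dot_conj form v) [form _ v]ei rmorph0 mulr0.
- by rewrite eqSS ef.
Qed.

Lemma acos_le_pihalf (t : R) : 0 <= t <= 1 -> acos t <= pi / 2.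
Proof.
move=> /andP[t0 t1].
have tI : -1 <= t <= 1 by rewrite t1 (le_trans _ t0) // lerN10.
rewrite leNgt -ltr_cos ?in_itv /= ?acos_ge0 ?acos_lepi //.
  by rewrite cos_pihalf acosK // -leNgt.
by rewrite divr_ge0 ?pi_ge0 // ler_pdivrMr // ler_peMr ?pi_ge0 // ler1n.
Qed.

(** The arccosines of the singular values, once sorted; both bases are permuted
    along with them. *)
Lemma exists_principal_angles V W : \dim V = \dim W ->
  exists th, is_principal_angles form (V := V) (W := W) th.
Proof.
move=> dVW; have [e [f [c [[sze oe eV] [szf o_f fW] szc c01 ef]]]] :=
  exists_biorthogonal_bases dVW.
have sz_th : size [seq acos t | t <- c] == \dim V by rewrite size_map szc.
pose th := Tuple sz_th.
(* the permutation p that sorts the angles reorders e and f as well *)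
have /tuple_permP[p sort_th] : perm_eq (sort <=%R th) th by rewrite perm_sort.
pose permute (T : nmodType) (g : seq T) :=
  [seq g`_(p i) | i <- enum 'I_(\dim V)].
have sz_permute (T : nmodType) (g : seq T) : size (permute _ g) = \dim V.
  by rewrite size_map size_enum_ord.
have nth_permute (T : nmodType) (g : seq T) j (jn : (j < \dim V)%N) :
    (permute _ g)`_j = g`_(p (Ordinal jn)).
  rewrite (nth_map (Ordinal jn)) ?size_enum_ord //.
  by rewrite (nth_ord_enum _ (Ordinal jn)).
have orth_permute (g : seq X) : size g = \dim V -> orthonormal form g ->
    orthonormal form (permute _ g).
  move=> szg /orthonormal_nthP og; apply/orthonormal_nthP => i j.
  rewrite sz_permute => il jl; rewrite !nth_permute og ?szg //.
  by rewrite val_eqE (inj_eq perm_inj) -val_eqE.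
have sub_permute (g : seq X) U : size g = \dim V -> {subset g <= U} ->
    {subset permute _ g <= U}.
  by move=> szg gU _ /mapP[i _ ->]; rewrite gU // mem_nth ?szg.
have th_permute : permute _ th = sort <=%R th.
  by rewrite sort_th /= /permute; apply: eq_map => i; rewrite (tnth_nth 0).
have sz1 : size (permute _ th) == minn (\dim V) (\dim W).
  by rewrite sz_permute -dVW minnn.
have sz2 : size (permute _ e) == \dim V by rewrite sz_permute.
have sz3 : size (permute _ f) == \dim W by rewrite sz_permute dVW.
exists (Tuple sz1); split=> /=.
- by rewrite th_permute sort_sorted //; exact: le_total.
- move=> t; have th_sub : t \in permute _ th -> t \in [seq acos t | t <- c].
    by rewrite th_permute mem_sort.
  move=> /th_sub/mapP[u /c01 u01 ->].
  rewrite acos_le_pihalf // andbT acos_ge0 //.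
  by case/andP: u01 => u0 ->; rewrite (le_trans _ u0) // lerN10.
exists (Tuple sz2), (Tuple sz3); split=> [||i j] /=.
- split; last exact: orth_permute.
  apply: orthonormal_basis_of; last exact/eqP.
    exact: orth_permute.
  exact: sub_permute.
- split; last exact: orth_permute.
  apply: orthonormal_basis_of; last exact/eqP.
    exact: orth_permute.
  exact: sub_permute.
have jn : (j < \dim V)%N by rewrite dVW.
rewrite /ip !(tnth_nth 0) /= !nth_permute // ef //.
rewrite val_eqE (inj_eq perm_inj) -val_eqE /=.
case: eqVneq => // ij; congr (of_real _).
rewrite (nth_map 0) ?szc // acosK // in_itv /=.
have /c01/andP[c0 ->] : c`_(p (Ordinal (ltn_ord i))) \in c.
  by rewrite mem_nth ?szc.
by rewrite (le_trans _ c0) // lerN10.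
Qed.

End PrincipalAngles.

(** * Products of vectors as minors, and the Pluecker line *)

Section Blades.
Variables (R : realType) (s : scalar_kind) (X : vectType (scalar_field R s)).
Local Notation K := (scalar_field R s).
Local Notation n := (\dim {:X}).
Local Notation bX := (vbasis {:X}).
Implicit Types (S T : {set 'I_n}) (vs : seq X) (U V W : {vspace X}).

(** The maximal minor, on the columns in S, of the matrix whose rows are the
    coordinates of the vectors of [vs]; it is 0 when that submatrix is not
    square, as products of different degrees have disjoint supports. *)
Definition minor S vs : K :=
  if size vs == #|S| then
    \det (\matrix_(i < #|S|, j < #|S|) coord bX (enum_val j) vs`_i)
  else 0.

Lemma minor_lin S (l r : seq X) (a : K) (x y : X) :
  minor S (l ++ (a *: x + y) :: r) =
  a * minor S (l ++ x :: r) + minor S (l ++ y :: r).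
Proof.
rewrite /minor !size_cat /=; case: eqP => [sz|_]; last by rewrite mulr0 addr0.
have lS : (size l < #|S|)%N by rewrite -sz addnS ltnS leq_addr.
rewrite -[X in _ = _ + X]mul1r.
have other_rows (u w : X) (i : 'I_(#|S|.-1)) :
    (l ++ u :: r)`_(lift (Ordinal lS) i) = (l ++ w :: r)`_(lift (Ordinal lS) i).
  rewrite !nth_cat; case: ltnP => // li; case d: (_ - _)%N => [|k] //=.
  have := neq_bump (size l) i; rewrite eqn_leq li /=.
  by rewrite -subn_eq0 d.
apply: (determinant_multilinear (i0 := Ordinal lS)).
- apply/rowP => j; rewrite !mxE /= !nth_cat ltnn subnn /= mul1r.
  by rewrite linearP.
- by apply/matrixP => i j; rewrite !mxE (other_rows x (a *: x + y)).
- by apply/matrixP => i j; rewrite !mxE (other_rows y (a *: x + y)).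
Qed.

Lemma minor_alt S vs : ~~ uniq vs -> minor S vs = 0.
Proof.
rewrite /minor; case: eqP => [sz|//] /(uniqPn 0)[i [j [ij jn eij]]].
rewrite sz in jn; have in_ := ltn_trans ij jn.
apply: (determinant_alternate (i1 := Ordinal in_) (i2 := Ordinal jn)).
  by rewrite -val_eqE /= ltn_eqF.
by move=> k; rewrite !mxE /= eij.
Qed.

Lemma minor_basis_vectors S T : minor S (basis_vectors T) = (T == S)%:R.
Proof.
have nth_basis (i : 'I_#|T|) : (basis_vectors T)`_i = bX`_(enum_val i).
  rewrite (nth_map (enum_val i)) -?cardE // -enum_val_nth.
  exact: tnth_nth.
have coord_bX (i j : 'I_n) : coord bX j bX`_i = (i == j)%:R.
  exact/coord_free/(basis_free (vbasisP _)).
rewrite /minor size_map -cardE; case: eqP => [cTS|]; last first.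
  by case: (eqVneq T S) => // -> [].
case: eqVneq => [eTS|nTS].
  subst T; rewrite -[RHS](det1 _ #|S|); congr (\det _); apply/matrixP => i j.
  by rewrite !mxE nth_basis coord_bX (inj_eq enum_val_inj).
(* a basis vector in S but not in T gives a zero column *)
have /subsetPn[x xS xT] : ~~ (S \subset T).
  by apply: contra nTS => sST; rewrite eq_sym eqEcard sST cTS leqnn.
rewrite (expand_det_col _ (enum_rank_in xS x)) big1 // => i _.
rewrite mxE enum_rankK_in //.
have iT : (i < #|T|)%N by rewrite cTS.
rewrite (nth_basis (Ordinal iT)) coord_bX.
case: eqVneq => [ix|_]; last by rewrite mul0r.
by case/negP: xT; rewrite -ix enum_valP.
Qed.

(** An alternating multilinear function is the combination, with coefficients
    [blade vs T], of its values on the basis products e_T; for [minor S] these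
    values are 1 if T = S and 0 otherwise. *)
Lemma blade_coord vs S : blade vs S = minor S vs.
Proof.
have := multilinear_alternating_blade (minor_lin S) (@minor_alt S) vs [::].
move=> /= <-.
rewrite (bigD1 S) //= minor_basis_vectors eqxx mulr1 big1 ?addr0 // => T TS.
by rewrite minor_basis_vectors (negPf TS) mulr0.
Qed.

(** Coordinatewise this is det (A B) = det A * det B, by [blade_coord]. *)
Lemma blade_linear_combination p (A : 'M[K]_p) (us e : seq X) :
  size us = p -> size e = p ->
  (forall i : 'I_p, us`_i = \sum_j A i j *: e`_j) ->
  blade us = \det A *: blade e.
Proof.
move=> szu sze uA; apply/ffunP => S.
rewrite [in RHS]ffunE !blade_coord /minor szu sze.
case: eqP => [pS|_]; last by rewrite scaler0.
clear szu sze; subst p.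
transitivity (\det (A *m \matrix_(i, j) coord bX (enum_val j) e`_i));
  last exact: det_mulmx.
congr (\det _).
apply/matrixP => i j; rewrite !mxE uA linear_sum; apply: eq_bigr => k _.
by rewrite linearZ mxE.
Qed.

(** By [blade_linear_combination], the products that span Lambda^p U are
    multiples of [blade e]; by [blade_ext_power], [blade e] is in their span. *)
Lemma pluecker_line U e : basis_of U e -> pluecker U = <[blade e]>%VS.
Proof.
move=> bU; rewrite -[e]in_tupleE in bU; have sze := esym (size_basis bU).
apply/eqP; rewrite eqEsubv; apply/andP; split; last first.
  rewrite -memvE /pluecker -sze; apply: blade_ext_power => x; exact: basis_mem.
apply/span_subvP => _ /mapP[t _ ->].
set us := map _ _.
pose A := \matrix_(i < \dim U, j < \dim U)
  coord (in_tuple e) (cast_ord (esym sze) j) us`_i.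
rewrite (@blade_linear_combination _ A us e) ?memvZ ?memv_line //.
  by rewrite size_map size_tuple.
move=> i; have uU : us`_i \in U.
  rewrite (nth_map (tnth t i)) ?size_tuple //; exact/vbasis_mem/mem_tnth.
rewrite {1}(coord_basis bU uU) (reindex (cast_ord (esym sze))) /=; last first.
  by exists (cast_ord sze) => j _; rewrite ?cast_ordK ?cast_ordKV.
by apply: eq_bigr => j _; rewrite mxE.
Qed.

Variable form : {dot X for scalar_conj R s}.

Lemma blade_ip_orthonormal e : orthonormal form e -> blade_ip form e e = 1.
Proof.
move=> /orthonormal_nthP oe; rewrite /blade_ip eqxx -[RHS](det1 _ (size e)).
congr (\det _); apply/matrixP => i j; rewrite !mxE /ip oe //.
by rewrite eq_sym.
Qed.

(** Orthonormal families have Gram determinant 1, so their products are unit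
    vectors spanning the Pluecker lines. *)
Lemma dFS_orthonormal V W e f : basis_of V e -> orthonormal form e ->
  basis_of W f -> orthonormal form f ->
  dFS form V W = acos (scalar_re `|blade_ip form e f|).
Proof.
move=> bV oe bW o_f; rewrite /dFS (pluecker_line bV) (pluecker_line bW).
have blade_neq0 g : orthonormal form g -> blade g != 0.
  move=> og; apply: contra_eq_neq (ext_ip_blade form g g) => ->.
  rewrite blade_ip_orthonormal // /ext_ip big1 => [|I _].
    by rewrite eq_sym oner_eq0.
  by rewrite big1 // => J _; rewrite ffunE rmorph0 !mul0r.
have norm1 g : orthonormal form g -> ip_norm (ext_ip form) (blade g) = 1.
  move=> og; rewrite /ip_norm ext_ip_blade blade_ip_orthonormal //.
  rewrite -(rmorph1 (scalar_of_real R s)).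
  have -> : scalar_re (scalar_of_real R s 1) = 1 :> R by case: (s).
  exact: sqrtr1.
by rewrite fubini_study_line ?blade_neq0 // ext_ip_blade !norm1 // mulr1 divr1.
Qed.

End Blades.

(** * Comparison of the Fubini-Study distance with the angles *)

Section Comparison.
Variables (R : realType) (s : scalar_kind) (X : vectType (scalar_field R s)).
Variable form : {dot X for scalar_conj R s}.
Local Notation of_real := (scalar_of_real R s).
Implicit Types (V W : {vspace X}).

Lemma dFS_sym V W : dFS form V W = dFS form W V.
Proof.
have [e [bV oe]] := exists_orthonormal_basis form V.
have [f [bW o_f]] := exists_orthonormal_basis form W.
rewrite (dFS_orthonormal bV oe bW o_f) (dFS_orthonormal bW o_f bV oe).
by rewrite blade_ip_conj scalar_norm_conj.
Qed.

Lemma dFS_neq_dim V W : \dim V <> \dim W -> dFS form V W = pi / 2.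
Proof.
move=> dVW; have [e [sze oe eV]] := exists_orthonormal_seq form V.
have [f [szf o_f fW]] := exists_orthonormal_seq form W.
have bV := orthonormal_basis_of oe eV sze.
have bW := orthonormal_basis_of o_f fW szf.
rewrite (dFS_orthonormal bV oe bW o_f) /blade_ip sze szf.
case: eqP => // _; rewrite normr0 -acos0; congr acos.
by case: (s).
Qed.

Lemma principal_angles_range V W :
  {in principal_angles form V W, forall t, 0 <= t <= pi / 2}.
Proof.
(* the default value of [principal_angles] consists of zeros *)
rewrite /principal_angles; case: xgetP => [th _ [_ th_range _]|_] //.
by move=> t /nseqP[-> _]; rewrite lexx divr_ge0 ?pi_ge0.
Qed.

Lemma prod_cos_principal_angles V W :
  0 <= \prod_(t <- principal_angles form V W) cos t <= 1.
Proof.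
have cos01 t : t \in principal_angles form V W -> 0 <= cos t <= 1.
  move/principal_angles_range => /andP[t0 tpi]; rewrite cos_le1 andbT.
  rewrite cos_ge0_pihalf // tpi andbT (le_trans _ t0) //.
  by rewrite oppr_le0 divr_ge0 ?pi_ge0.
rewrite big_seq prodr_ge0 => [|t /cos01/andP[] //].
by rewrite prodr_ile1 // => t /cos01.
Qed.

Lemma blade_ip_principal V W (th : (minn (\dim V) (\dim W)).-tuple R)
    (e : (\dim V).-tuple X) (f : (\dim W).-tuple X) : \dim V = \dim W ->
  (forall (i : 'I_(\dim V)) (j : 'I_(\dim W)),
     ip form (tnth e i) (tnth f j) =
       if i == j :> nat then of_real (cos th`_i) else 0) ->
  blade_ip form e f = of_real (\prod_(t <- th) cos t).
Proof.
move=> dVW ef; have sz_th : size th = \dim V by rewrite size_tuple -dVW minnn.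
rewrite /blade_ip !size_tuple; case: eqP => // _.
rewrite (_ : (\matrix_(i, j) _) = diag_mx (\row_i of_real (cos th`_i))).
  rewrite det_diag (big_nth 0) big_mkord sz_th rmorph_prod.
  by apply: eq_bigr => i _; rewrite mxE.
apply/matrixP => i j; rewrite !mxE.
have := ef i (cast_ord dVW j); rewrite !(tnth_nth 0) /= => ->.
by rewrite val_eqE; case: eqVneq => // ->.
Qed.

Lemma grassmann_angle_eq_dim V W : \dim V = \dim W ->
  grassmann_angle form V W = dFS form V W.
Proof.
move=> dVW; rewrite /grassmann_angle.
have -> : (\dim V <= \dim W)%N by rewrite dVW.
have [V0|V0] := eqVneq V 0%VS.
  have W0 : W = 0%VS by apply/eqP; rewrite -dimv_eq0 -dVW V0 dimv0.
  have b0 : basis_of (0%VS : {vspace X}) [::] by exact: nil_basis.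
  have o0 : orthonormal form [::] by [].
  rewrite V0 W0 (dFS_orthonormal b0 o0 b0 o0) blade_ip_orthonormal //.
  by rewrite -(rmorph1 of_real) scalar_re_norm_of_real // acos1.
rewrite -(dimv_eq0 W) -{1}dVW dimv_eq0 (negPf V0).
have [_ _ [e [f [[bV oe] [bW o_f] ef]]]] :=
  xgetPex [tuple of nseq _ 0] (exists_principal_angles form dVW).
rewrite (dFS_orthonormal bV oe bW o_f) (blade_ip_principal dVW ef).
rewrite scalar_re_norm_of_real //.
by have /andP[] := prod_cos_principal_angles V W.
Qed.

Lemma grassmann_angle_le_pihalf V W : grassmann_angle form V W <= pi / 2.
Proof.
rewrite /grassmann_angle; case: ifP => _; first by rewrite divr_ge0 ?pi_ge0.
case: ifP => // _; case: ifP => // _; apply: acos_le_pihalf.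
exact: prod_cos_principal_angles.
Qed.

End Comparison.

Theorem theorem4p13 (R : realType) (s : scalar_kind)
    (X : vectType (scalar_field R s)) (form : {dot X for scalar_conj R s})
    (V W : {vspace X}) :
  dFS form V W = grassmann_angle_max form V W.
Proof.
rewrite /grassmann_angle_max; case: (ltngtP (\dim V) (\dim W)) => dVW.
- have W0 : W != 0%VS by rewrite -dimv_eq0 -lt0n (leq_ltn_trans _ dVW).
  have -> : grassmann_angle form W V = pi / 2.
    by rewrite /grassmann_angle (negPf W0) leqNgt dVW if_same.
  rewrite dFS_neq_dim; last by apply/eqP; rewrite ltn_eqF.
  by rewrite max_r // grassmann_angle_le_pihalf.
- have V0 : V != 0%VS by rewrite -dimv_eq0 -lt0n (leq_ltn_trans _ dVW).
  have -> : grassmann_angle form V W = pi / 2.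
    by rewrite /grassmann_angle (negPf V0) leqNgt dVW if_same.
  rewrite dFS_neq_dim; last by apply/eqP; rewrite gtn_eqF.
  by rewrite max_l // grassmann_angle_le_pihalf.
- by rewrite !grassmann_angle_eq_dim // (dFS_sym form W V) maxxx.
Qed.
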